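(* Fix integers $n\geq 8$, $f\geq 0$ and $k\geq 2$. Then there exists a finite simple non-complete connected graph $G$ on the vertex set $[n]=\{1,\ldots,n\}$ with $f(G)=f$, $\operatorname{diam}(G)=2$ and $\kappa(G)=k$ if and only if one of the following conditions is satisfied: (1) $f=0$ and $2\leq k\leq n-2$; (2) $f=1$ and $2\leq k\leq n-3$; (3) $f\geq 2$, $k\geq 2$ and $f+k\leq n$.
   Context: For a finite simple connected graph $G$ on $[n]$: the distance of two distinct vertices is the smallest length (number of edges) of a path in $G$ connecting them, and $\operatorname{diam}(G)$ is the maximum of all such distances. $\kappa(G)$ denotes the vertex connectivity: for non-complete $G$, the smallest cardinality of a subset $T\subset[n]$ such that the induced subgraph of $G$ on $[n]\setminus T$ is disconnected. A vertex $i$ is free (simplicial) if whenever $\{i,j\},\{i,j'\}\in E(G)$ with $j\neq j'$, then $\{j,j'\}\in E(G)$. $f(G)$ denotes the number of free vertices of $G$. *)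

(* Defs.v *)
From mathcomp Require Import all_boot.
Set Implicit Arguments.
Unset Strict Implicit.
Unset Printing Implicit Defensive.

Record sgraph (T : finType) := SGraph {
  adj :> rel T;
  adj_sym : symmetric adj;
  adj_irrefl : irreflexive adj
}.

Section GraphInvariants.
Variables (T : finType) (G : sgraph T).

Definition induced_adj (A : {set T}) : rel T :=
  [rel u v | [&& u \in A, v \in A & G u v]].

Definition connected_on (A : {set T}) : bool :=
  [forall x in A, forall y in A, connect (induced_adj A) x y].

Definition connected_graph : bool := connected_on [set: T].

Definition complete_graph : bool :=
  [forall x, forall y, (x != y) ==> G x y].

(* A path with m edges has m + 1 pairwise distinct vertices x :: p. *)
Definition has_path (m : nat) (x y : T) : bool :=
  [exists p : m.-tuple T,
    [&& path G x p, uniq (x :: p) & last x p == y]].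

(* Paths have fewer than #|T| edges; the value is #|T| when there is no path
   from x to y, which does not happen in a connected graph. *)
Definition dist (x y : T) : nat :=
  \big[minn/#|T|]_(m < #|T| | has_path m x y) m.

Definition diam : nat :=
  \max_(xy : T * T | xy.1 != xy.2) dist xy.1 xy.2.

(* A complete graph has no disconnecting set and gets the value #|T|.-1.
   The default is not reached otherwise: removing all vertices but two
   nonadjacent ones disconnects the graph, so the minimum is at most #|T| - 2. *)
Definition vertex_connectivity : nat :=
  \big[minn/#|T|.-1]_(S : {set T} | ~~ connected_on (~: S)) #|S|.

Definition free_vertex (i : T) : bool :=
  [forall j, forall j', [&& G i j, G i j' & j != j'] ==> G j j'].

Definition num_free : nat := #|[set i | free_vertex i]|.

End GraphInvariants.

(* Main.v *)
(* For the necessity, let v be a free vertex of a non-complete graph.  Adjacent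
   free vertices are twins, so the non-free neighbours of v separate v from any
   vertex not adjacent to it, whence f + k <= n.  If moreover f = 1, then v has
   at least two non-neighbours: a unique non-neighbour would have all its
   neighbours in the clique N(v) and would be free as well.  Hence N(v) is a cut
   of size at most n - 3.
   Each of the three extremal families below has a vertex n - 1 whose
   neighbourhood {0, ..., k - 1} is a minimum cut. *)
Require Import Defs.
From mathcomp Require Import all_boot.
From mathcomp Require Import zify.

Set Implicit Arguments.
Unset Strict Implicit.
Unset Printing Implicit Defensive.

(** * Minima over finite families *)

Lemma bigmin_geq (I : Type) (r : seq I) (P : pred I) (F : I -> nat) (d k : nat) :
  k <= d -> (forall i, P i -> k <= F i) -> k <= \big[minn/d]_(i <- r | P i) F i.
Proof.
move=> kd kF; apply: (big_ind (fun m => k <= m)) => // a b ka kb.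
by rewrite leq_min ka.
Qed.

Lemma bigmin_leq (I : finType) (P : pred I) (F : I -> nat) (d : nat) (i : I) :
  P i -> \big[minn/d]_(j | P j) F j <= F i.
Proof.
move=> Pi; have := mem_index_enum i; elim: (index_enum I) => //= j r IHr.
rewrite inE big_cons => /predU1P[<-|/IHr le_r]; first by rewrite Pi geq_minl.
by case: (P j) => //; rewrite geq_min le_r orbT.
Qed.

(** * Cuts, free vertices and distances in an arbitrary graph *)

Section Graphs.
Variables (T : finType) (G : sgraph T).
Implicit Types (x y v w : T) (A S : {set T}).

Lemma induced_adjE A x y : induced_adj G A x y = [&& x \in A, y \in A & G x y].
Proof. by []. Qed.

Lemma connected_on_root A v :
  {in A, forall x, connect (induced_adj G A) v x} -> connected_on G A.
Proof.
move=> vA; have symA : connect_sym (induced_adj G A).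
  by apply: sym_connect_sym => x y; rewrite !induced_adjE adj_sym andbCA.
apply/forall_inP => x xA; apply/forall_inP => y yA.
by apply: connect_trans (vA y yA); rewrite symA vA.
Qed.

Lemma connect_common_nbr A x y z :
  x \in A -> y \in A -> z \in A -> G x z -> G y z ->
  connect (induced_adj G A) x y.
Proof.
move=> xA yA zA xz yz; apply: (@connect_trans _ _ z); apply: connect1; rewrite induced_adjE.
  by rewrite xA zA.
by rewrite yA zA adj_sym.
Qed.

Lemma not_complete_graph x y : x != y -> ~~ G x y -> ~~ complete_graph G.
Proof.
move=> xy nxy; apply/negP => /forallP/(_ x)/forallP/(_ y).
by rewrite xy (negbTE nxy).
Qed.

(** A path that avoids [S] and starts in [A] never leaves [A], so it cannot reach [w]: removing [S]
    disconnects the graph. *)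
Lemma vertex_connectivity_le_cut A S v w :
  v \in A -> v \notin S -> w \notin A -> w \notin S ->
  (forall a b, a \in A -> G a b -> (b \in A) || (b \in S)) ->
  vertex_connectivity G <= #|S|.
Proof.
move=> vA vS wA wS clA; apply: bigmin_leq; apply/negP => /forall_inP/(_ v).
rewrite inE vS => /(_ isT)/forall_inP/(_ w); rewrite inE wS => /(_ isT).
case/connectP => p pth lastp; case/negP: wA; rewrite lastp {lastp}.
elim: p v vA {vS} pth => //= a p IHp v vA /andP[].
rewrite induced_adjE => /and3P[_].
rewrite inE => aS va; apply: IHp.
by have := clA _ _ vA va; rewrite (negbTE aS) orbF.
Qed.

Lemma vertex_connectivity_le_nbrs v w :
  v != w -> ~~ G v w -> vertex_connectivity G <= #|[set x | G v x]|.
Proof.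
move=> vw nvw; apply: (@vertex_connectivity_le_cut [set v] _ v w).
- by rewrite inE.
- by rewrite inE adj_irrefl.
- by rewrite inE eq_sym.
- by rewrite inE.
- by move=> a b /set1P-> vb; rewrite !inE vb orbT.
Qed.

Lemma vertex_connectivity_le_card :
  ~~ complete_graph G -> vertex_connectivity G <= #|T| - 2.
Proof.
case/forallPn => x /forallPn[y]; rewrite negb_imply => /andP[xy nxy].
have -> : #|T| - 2 = #|~: [set x; y]| by have := cardsC [set x; y]; rewrite cards2 xy; lia.
apply: (@vertex_connectivity_le_cut [set x] _ x y); rewrite ?inE ?eqxx ?orbT //.
  by rewrite eq_sym.
by move=> a b /set1P-> xb; rewrite !inE; case: eqP => //= _; apply: contraNN nxy => /eqP <-.
Qed.

(** The bound [k < #|T|] keeps [k] below the default [#|T|.-1] of the minimum. *)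
Lemma vertex_connectivity_geq k :
  k < #|T| -> (forall S, #|S| < k -> connected_on G (~: S)) ->
  k <= vertex_connectivity G.
Proof.
move=> kT conn; apply: bigmin_geq; first by lia.
by move=> S; apply: contraR; rewrite -ltnNge => /conn.
Qed.

Lemma free_vertexP v :
  reflect (forall x y, G v x -> G v y -> x != y -> G x y) (free_vertex G v).
Proof.
apply: (iffP forallP) => [fv x y vx vy xy | fv x].
  by have /forallP/(_ y) := fv x; rewrite vx vy xy.
by apply/forallP => y; apply/implyP => /and3P[]; apply: fv.
Qed.

Lemma not_free_vertex v x y :
  G v x -> G v y -> x != y -> ~~ G x y -> ~~ free_vertex G v.
Proof. by move=> vx vy xy; apply: contra => /free_vertexP; apply. Qed.

(** Otherwise [v] sees all other vertices, and freeness makes them a clique. *)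
Lemma free_nonadjacent v :
  ~~ complete_graph G -> free_vertex G v -> exists2 w, v != w & ~~ G v w.
Proof.
move=> ncG /free_vertexP fv.
have [/existsP[w /andP[]]|/existsPn allv] := boolP [exists w, (v != w) && ~~ G v w].
  by exists w.
have vall w : v != w -> G v w by have := allv w; case: eqP => //= _; rewrite negbK.
case/negP: ncG; apply/forallP => x; apply/forallP => y; apply/implyP => xy.
have [xv|nvx] := eqVneq x v; first by rewrite xv vall // -xv.
have [->|nvy] := eqVneq y v; first by rewrite adj_sym vall // eq_sym.
by apply: fv => //; apply: vall; rewrite eq_sym.
Qed.

(* Adjacent free vertices have the same closed neighbourhood, so the non-free
   neighbours of [v] separate the free vertices of that neighbourhood from the
   rest of the graph. *)
Lemma num_free_add_connectivity :
  ~~ complete_graph G -> 0 < num_free G ->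
  num_free G + vertex_connectivity G <= #|T|.
Proof.
move=> ncG /card_gt0P[v]; rewrite inE => fv.
have [w vw nvw] := free_nonadjacent ncG fv.
set F := [set i | free_vertex G i].
(* This set avoids all free vertices, so it has at most [#|T| - num_free G] elements. *)
suff: vertex_connectivity G <= #|[set x | G v x] :\: F|.
  have : #|[set x | G v x] :\: F| <= #|~: F|.
    by apply: subset_leq_card; apply/subsetP => x; rewrite !inE => /andP[].
  by have := cardsC F; rewrite /num_free -/F; lia.
apply: (@vertex_connectivity_le_cut [set x in F | (x == v) || G v x] _ v w).
- by rewrite !inE fv eqxx.
- by rewrite !inE fv.
- by rewrite !inE (negbTE nvw) eq_sym (negbTE vw) andbF.
- by rewrite !inE (negbTE nvw) andbF.
move=> a b; rewrite !inE => /andP[fa va] ab.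
(* As [a] is free and lies in the closed neighbourhood of [v], so do its neighbours. *)
have : (b == v) || G v b.
  case/predU1P: va => [<-|va]; first by rewrite ab orbT.
  have [//|bv] /= := eqVneq b v; rewrite adj_sym.
  by move/free_vertexP: fa; apply; rewrite // adj_sym.
case fb: (free_vertex G b) => /=; first by move=> ->.
by case/predU1P => [bv|//]; rewrite bv fv in fb.
Qed.

Lemma vertex_connectivity_one_free :
  ~~ complete_graph G -> num_free G = 1 -> vertex_connectivity G <= #|T| - 3.
Proof.
move=> ncG f1; have /card_gt0P[v] : 0 < num_free G by rewrite f1.
rewrite inE => fv.
have freeE u : free_vertex G u -> u = v.
  move/eqP: f1 => /cards1P[a setE] fu.
  have : (u \in [set a]) && (v \in [set a]) by rewrite -setE !inE fu fv.
  by rewrite !inE => /andP[/eqP-> /eqP->].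
have [w vw nvw] := free_nonadjacent ncG fv.
have {}freeE : ~~ free_vertex G w by apply: contraNN vw => /freeE->.
have [u vu] : exists2 u, v != u /\ u != w & ~~ G v u.
  have [/existsP[u /and3P[]]|/existsPn allv] :=
    boolP [exists u, [&& v != u, u != w & ~~ G v u]]; first by exists u.
  case/negP: freeE; apply/free_vertexP.
  have nbr x : G w x -> G v x.
    move=> wx; have := allv x; rewrite !negb_and !negbK.
    case/or3P => [/eqP vx|/eqP xw|//]; first by rewrite vx adj_sym wx in nvw.
    by rewrite xw adj_irrefl in wx.
  by move=> x y /nbr vx /nbr vy; move/free_vertexP: fv; apply.
case: vu => vu uw nvu.
apply: leq_trans (vertex_connectivity_le_nbrs vw nvw) _.
(* Three distinct vertices [v], [w], [u] lie outside the neighbourhood of [v]. *)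
have : #|[set x | G v x] :|: [set v; w; u]| <= #|T| by apply: max_card.
rewrite cardsU disjoint_setI0 ?cards0 ?subn0.
  by rewrite setUC cardsU1 cards2 !inE negb_or vw uw (eq_sym u v) vu; lia.
rewrite disjoint_sym disjoints_subset; apply/subsetP => x; rewrite !inE.
by case/orP => [/orP[]|] /eqP->; rewrite ?adj_irrefl ?(negbTE nvw) ?(negbTE nvu).
Qed.

Lemma dist_le m x y : m < #|T| -> has_path G m x y -> dist G x y <= m.
Proof.
by move=> mT; apply: (@bigmin_leq _ (fun i : 'I_#|T| => has_path G i x y)
  (fun i => i) _ (Ordinal mT)).
Qed.

(** Length 0 forces [x = y] and length 1 forces adjacency; [1 < #|T|] covers the default of the
    minimum. *)
Lemma dist_ge2 x y : 1 < #|T| -> x != y -> ~~ G x y -> 2 <= dist G x y.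
Proof.
move=> T1 xy nxy; apply: bigmin_geq => // -[m /= _].
case/existsP => p; case/and3P; case: p => p /= /eqP <-.
case: p => [|a [|b p]] //=; first by rewrite (negbTE xy).
by move=> /andP[xa _] _ /eqP ay; rewrite ay (negbTE nxy) in xa.
Qed.

Lemma diam2 :
  2 < #|T| -> ~~ complete_graph G ->
  (forall x y, x != y -> ~~ G x y -> exists2 z, G x z & G y z) ->
  connected_graph G /\ diam G = 2.
Proof.
move=> T2 ncG common.
have loopless x y : G x y -> x != y.
  by apply: contraTneq => ->; rewrite adj_irrefl.
split.
  apply/forall_inP => x _; apply/forall_inP => y _.
  have [-> //|xy] := eqVneq x y.
  have [Gxy|/(common _ _ xy)[z xz yz]] := boolP (G x y).
    by apply: connect1; rewrite induced_adjE !inE.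
  by apply: connect_common_nbr xz yz; rewrite inE.
apply/eqP; rewrite eqn_leq; apply/andP; split.
  apply/bigmax_leqP => -[x y] /= xy.
  have [Gxy|/(common _ _ xy)[z xz yz]] := boolP (G x y).
    apply: leq_trans (dist_le (m := 1) _ _) _ => //; first by lia.
    by apply/existsP; exists [tuple y]; rewrite /= Gxy inE xy eqxx.
  apply: dist_le => //; apply/existsP; exists [tuple z; y].
  rewrite /= xz (adj_sym G z) yz !inE negb_or xy eqxx loopless //.
  by rewrite loopless // adj_sym.
case/forallPn: ncG => x /forallPn[y]; rewrite negb_imply => /andP[xy nxy].
apply: leq_trans (dist_ge2 _ xy nxy) _; first by lia.
exact: (@leq_bigmax_cond _ _ (fun z : T * T => dist G z.1 z.2) (x, y)).
Qed.

End Graphs.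

(** * Graphs on ordinals from a relation on integers *)

Section OrdGraph.
Variables (n : nat) (e : rel nat).

(** Reading [e] only on increasing pairs gives symmetry and irreflexivity for every [e]. *)
Definition ord_adj : rel 'I_n :=
  fun i j => (i < j) && e i j || (j < i) && e j i.

Lemma ord_adj_sym : symmetric ord_adj.
Proof. by move=> i j; rewrite /ord_adj orbC. Qed.

Lemma ord_adj_irrefl : irreflexive ord_adj.
Proof. by move=> i; rewrite /ord_adj ltnn. Qed.

Definition ord_graph : sgraph 'I_n := SGraph ord_adj_sym ord_adj_irrefl.

Lemma ord_graphE (i j : 'I_n) :
  ord_graph i j = (i < j) && e i j || (j < i) && e j i.
Proof. by []. Qed.

End OrdGraph.

Lemma exists_ord n a : a < n -> exists i : 'I_n, i = a :> nat.
Proof. by move=> an; exists (Ordinal an). Qed.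

Lemma card_ord_lt n k : k <= n -> #|[set i : 'I_n | i < k]| = k.
Proof.
move=> kn; rewrite cardsE -sum1_card -[RHS]card_ord -sum1_card.
by rewrite (big_ord_widen _ (fun _ => 1) kn).
Qed.

Lemma exists_notin (T : finType) (A S : {set T}) (k : nat) :
  #|S| < k -> k <= #|A| -> exists2 x, x \in A & x \notin S.
Proof.
move=> Sk /(leq_trans Sk) SA; suff /subsetPn[x] : ~~ (A \subset S) by exists x.
by apply: contraL SA => /subset_leq_card; rewrite -leqNgt.
Qed.

(** * Construction of graphs with prescribed [f] and [k] *)

Definition realizes n (G : sgraph 'I_n) f k : Prop :=
  ~~ complete_graph G /\ connected_graph G /\
  num_free G = f /\ diam G = 2 /\ vertex_connectivity G = k.

(** The neighbourhood of the last vertex is a cut of size [k]. A smaller [S] misses some [z < k],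
    from which every remaining vertex is reached. *)
Lemma realizesP n f k (G : sgraph 'I_n) :
  2 <= k -> k + 2 <= n ->
  (forall v i : 'I_n, v = n.-1 :> nat -> G v i = (i < k)) ->
  (forall x y : 'I_n, x < y -> ~~ G x y -> exists2 z, G x z & G y z) ->
  (forall (S : {set 'I_n}) (z y : 'I_n), #|S| < k -> z < k ->
     z \notin S -> y \notin S -> z != y -> ~~ G z y ->
     connect (induced_adj G (~: S)) z y) ->
  num_free G = f -> realizes G f k.
Proof.
move=> k2 kn lastG common conn numf.
have [v vE] : exists v : 'I_n, v = n.-1 :> nat by apply: exists_ord; lia.
have [w wE] : exists w : 'I_n, w = n.-2 :> nat by apply: exists_ord; lia.
have vw : v != w by rewrite -val_eqE /=; lia.
have nvw : ~~ G v w by rewrite lastG // wE; lia.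
have ncG := not_complete_graph vw nvw.
have [||connG diamG] := diam2 (G := G) _ ncG; first by rewrite card_ord; lia.
  move=> x y xy nxy; have : (x < y) || (y < x) by move: xy; rewrite -val_eqE /=; lia.
  case/orP => [/common|/common-/(_ _)[]]; [exact | by rewrite adj_sym |].
  by move=> z; exists z.
split=> //; do 3!split=> //; apply/eqP; rewrite eqn_leq; apply/andP; split.
  apply: leq_trans (vertex_connectivity_le_nbrs vw nvw) _.
  rewrite -[leqRHS](@card_ord_lt n) ?[X in X <= _]eq_card //; try lia.
  by apply: eq_leq; apply: eq_card => i; rewrite !inE lastG.
apply: vertex_connectivity_geq => [|S Sk]; first by rewrite card_ord; lia.
have [|z] := exists_notin (A := [set i : 'I_n | i < k]) Sk; first by rewrite card_ord_lt //; lia.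
rewrite inE => zk zS; apply: (@connected_on_root _ _ _ z) => y; rewrite inE => yS.
have [-> //|zy] := eqVneq z y.
have [Gzy|nzy] := boolP (G z y); last exact: conn.
by apply: connect1; rewrite induced_adjE !inE zS yS.
Qed.

(* The join of n - k isolated vertices with a complete graph on k vertices
   deprived of one edge. *)
Lemma realizes_no_free n k :
  2 <= k <= n - 2 -> exists G : sgraph 'I_n, realizes G 0 k.
Proof.
move=> /andP[k2 kn]; pose e i j := (i < k) && ~~ ((i == 0) && (j == 1)).
exists (ord_graph n e).
have [v0 v0E] : exists v : 'I_n, v = 0 :> nat by apply: exists_ord; lia.
have [v1 v1E] : exists v : 'I_n, v = 1 :> nat by apply: exists_ord; lia.
have [u uE] : exists v : 'I_n, v = n.-1 :> nat by apply: exists_ord; lia.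
have [w wE] : exists v : 'I_n, v = n.-2 :> nat by apply: exists_ord; lia.
apply: realizesP => //.
- by lia.
- by move=> v i vE; have := ltn_ord i; rewrite ord_graphE /e vE; lia.
- move=> x y xy; have := ltn_ord y; rewrite ord_graphE /e => yn nxy.
  (* The only missing edge with an end below [k] is {0, 1}. *)
  have [xk|xk] := ltnP x k; last by exists v0; rewrite ord_graphE /e v0E; lia.
  by exists u; rewrite ord_graphE /e uE; lia.
- move=> S z y Sk zk zS yS; rewrite ord_graphE -val_eqE /= /e => zy nzy.
  (* Here [z] and [y] are 0 and 1; all the other [n - 2 >= k] vertices are common neighbours. *)
  have [|a] := exists_notin (A := (~: [set i : 'I_n | i < 2])) Sk.
    by rewrite cardsCs setCK card_ord card_ord_lt //; lia.
  rewrite !inE -leqNgt => a2 aS; have := ltn_ord a => an.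
  by apply: (@connect_common_nbr _ _ _ _ _ a); rewrite ?inE // ord_graphE /e; lia.
- apply/eqP; rewrite cards_eq0; apply/eqP/setP => i; rewrite !inE; apply/negbTE.
  have [ik|ik] := ltnP i k.
    by apply: (@not_free_vertex _ _ _ u w);
      rewrite ?ord_graphE -?val_eqE /= /e ?uE ?wE; lia.
  by apply: (@not_free_vertex _ _ _ v0 v1);
    rewrite ?ord_graphE -?val_eqE /= /e ?v0E ?v1E; lia.
Qed.

(* The vertex n - 1 is attached to the first k vertices of a complete graph on
   n - 1 vertices deprived of the two disjoint edges {1, k} and {0, k + 1}. *)
Lemma realizes_one_free n k :
  2 <= k <= n - 3 -> exists G : sgraph 'I_n, realizes G 1 k.
Proof.
move=> /andP[k2 kn].
pose e i j := [&& (j < n.-1) || (i < k), ~~ ((i == 1) && (j == k))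
  & ~~ ((i == 0) && (j == k.+1))].
exists (ord_graph n e).
have [v0 v0E] : exists v : 'I_n, v = 0 :> nat by apply: exists_ord; lia.
have [v1 v1E] : exists v : 'I_n, v = 1 :> nat by apply: exists_ord; lia.
have [w wE] : exists v : 'I_n, v = k :> nat by apply: exists_ord; lia.
have [w' w'E] : exists v : 'I_n, v = k.+1 :> nat by apply: exists_ord; lia.
have [u uE] : exists v : 'I_n, v = n.-1 :> nat by apply: exists_ord; lia.
apply: realizesP => //.
- by lia.
- by move=> v i vE; have := ltn_ord i; rewrite ord_graphE /e vE; lia.
- move=> x y xy; have := ltn_ord y; rewrite ord_graphE /e => yn nxy.
  have [yl|yl] := eqVneq (y : nat) n.-1.
    have [xw'|xw'] := eqVneq (x : nat) k.+1.
      by exists v1; rewrite ord_graphE /e v1E; lia.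
    by exists v0; rewrite ord_graphE /e v0E; lia.
  have [x1|x1] := eqVneq (x : nat) 1.
    by exists v0; rewrite ord_graphE /e v0E; lia.
  by exists v1; rewrite ord_graphE /e v1E; lia.
- move=> S z y Sk zk zS yS; rewrite ord_graphE -val_eqE /= /e => zy nzy.
  have yn := ltn_ord y.
  (* The pair is one of the two deleted edges, and its common neighbours are the [n - 3 >= k]
     vertices other than [u], [z], [y]. *)
  have [|a] := exists_notin (A := (~: [set u; z; y])) Sk.
    rewrite cardsCs setCK card_ord setUC cardsU1 cards2.
    by case: (_ \notin _); case: (_ != _); lia.
  rewrite !inE !negb_or -!val_eqE /= uE => aE aS; have := ltn_ord a => an.
  by apply: (@connect_common_nbr _ _ _ _ _ a); rewrite ?inE // ord_graphE /e; lia.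
- apply/eqP/cards1P; exists u; apply/setP => i; rewrite !inE -val_eqE /= uE.
  have := ltn_ord i => ilt.
  have [il|il] := eqVneq (i : nat) n.-1.
    (* Each deleted edge has an end outside 0, ..., [k - 1], so these neighbours form a clique. *)
    have nbr x : ord_graph n e i x -> x < k.
      by have := ltn_ord x; rewrite ord_graphE /e; lia.
    by apply/free_vertexP => x y /nbr xk /nbr yk; rewrite ord_graphE -val_eqE /= /e; lia.
  apply/negbTE.
  have [ik|ik] := ltnP i k.
    have [i0|i0] := eqVneq (i : nat) 0.
      by apply: (@not_free_vertex _ _ _ u w);
        rewrite ?ord_graphE -?val_eqE /= /e ?uE ?wE; lia.
    have [i1|i1] := eqVneq (i : nat) 1.
      by apply: (@not_free_vertex _ _ _ u w');
        rewrite ?ord_graphE -?val_eqE /= /e ?uE ?w'E; lia.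
    by apply: (@not_free_vertex _ _ _ u w);
      rewrite ?ord_graphE -?val_eqE /= /e ?uE ?wE; lia.
  have [i1|i1] := eqVneq (i : nat) k.
    by apply: (@not_free_vertex _ _ _ v0 w');
      rewrite ?ord_graphE -?val_eqE /= /e ?v0E ?w'E; lia.
  by apply: (@not_free_vertex _ _ _ v1 w);
    rewrite ?ord_graphE -?val_eqE /= /e ?v1E ?wE; lia.
Qed.

(* The join of a complete graph on k - 1 vertices with a tree on the vertices
   k - 1, ..., n - 1: the internal vertices k - 1, ..., n - f - 1 form a path,
   the leaf n - f is attached to its end and the other leaves to its origin. *)
Lemma realizes_many_free n f k :
  2 <= f -> 2 <= k -> f + k <= n -> exists G : sgraph 'I_n, realizes G f k.
Proof.
move=> f2 k2 fkn.
pose e i j := [|| i < k.-1, (j <= n - f) && (i == j.-1)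
  | (n - f < j) && (i == k.-1)].
exists (ord_graph n e).
have [v0 v0E] : exists v : 'I_n, v = 0 :> nat by apply: exists_ord; lia.
have [u uE] : exists v : 'I_n, v = n.-1 :> nat by apply: exists_ord; lia.
have [w wE] : exists v : 'I_n, v = n.-2 :> nat by apply: exists_ord; lia.
apply: realizesP => //.
- by lia.
- by move=> v i vE; have := ltn_ord i; rewrite ord_graphE /e vE; lia.
- move=> x y xy; rewrite ord_graphE /e => nxy.
  by exists v0; rewrite ord_graphE /e v0E; lia.
- move=> S z y Sk zk zS yS; rewrite ord_graphE -val_eqE /= /e => zy nzy.
  (* A surviving vertex below [k - 1] is adjacent to all others. If none survives, [S] is exactly
     that clique and the tree remains. *)
  have [/existsP[a /andP[ak aS]]|/existsPn noa] :=
    boolP [exists a : 'I_n, (a < k.-1) && (a \notin S)].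
    by apply: (@connect_common_nbr _ _ _ _ _ a); rewrite ?inE // ord_graphE /e; lia.
  have SE : [set i : 'I_n | i < k.-1] = S.
    apply/eqP; rewrite eqEcard card_ord_lt; last by lia.
    rewrite andbC -ltnS prednK ?(ltnW k2) // Sk /=.
    by apply/subsetP => i; rewrite inE => ik; have := noa i; rewrite ik negbK.
  have yE : k.-1 <= y by move: yS; rewrite -SE inE; lia.
  have zE : z = k.-1 :> nat by move: zS; rewrite -SE inE; lia.
  (* Induction along the tree rooted at [z], with [p] the parent of [y]. *)
  have [m] := ubnP (nat_of_ord y); elim: m y yE {yS zy nzy} => // m IHm y yk ym.
  have [yz|yz] := eqVneq z y; first by rewrite yz.
  have zy : z < y by move: yz; rewrite -val_eqE /= zE; lia.
  have yn := ltn_ord y.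
  have [p pE] : exists p : 'I_n, p = (if y <= n - f then y.-1 else k.-1) :> nat.
    by apply: exists_ord; case: ifP; lia.
  apply: connect_trans (IHm p _ _) _; [by rewrite pE; case: ifP; lia.. |].
  apply: connect1; rewrite induced_adjE -SE !inE ord_graphE /e pE.
  by case: ifP; lia.
- rewrite /num_free.
  have -> : [set i | free_vertex (ord_graph n e) i] = ~: [set i : 'I_n | i < n - f].
    apply/setP => i; rewrite !inE -leqNgt; have ilt := ltn_ord i.
    have [fi|fi] := leqP (n - f) i.
      (* A leaf sees the clique and its single tree neighbour [p], which is joined to the clique. *)
      pose p := if i == n - f :> nat then i.-1 else k.-1.
      have nbr x : ord_graph n e i x -> (x < k.-1) || (x == p :> nat).
        by have := ltn_ord x; rewrite ord_graphE /e /p; case: ifP; lia.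
      apply/free_vertexP => x y /nbr xp /nbr yp.
      have pk : k.-1 <= p by rewrite /p; case: ifP; lia.
      by rewrite ord_graphE -val_eqE /= /e; lia.
    apply/negbTE.
    (* Clique vertices see two leaves, the origin sees its successor and the leaf [u], and any other
       internal vertex sees both its path neighbours. *)
    have [ik|ik] := ltnP i k.-1.
      by apply: (@not_free_vertex _ _ _ u w);
        rewrite ?ord_graphE -?val_eqE /= /e ?uE ?wE; lia.
    have [s sE] : exists v : 'I_n, v = i.+1 :> nat by apply: exists_ord; lia.
    have [i0|i0] := eqVneq (i : nat) k.-1.
      by apply: (@not_free_vertex _ _ _ s u);
        rewrite ?ord_graphE -?val_eqE /= /e ?uE ?sE; lia.
    have [p pE] : exists v : 'I_n, v = i.-1 :> nat by apply: exists_ord; lia.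
    by apply: (@not_free_vertex _ _ _ s p);
      rewrite ?ord_graphE -?val_eqE /= /e ?pE ?sE; lia.
  by rewrite cardsCs setCK card_ord card_ord_lt //; lia.
Qed.

Theorem theorem3p2 (n f k : nat) (hn : 8 <= n) (hf : 0 <= f) (hk : 2 <= k) :
  (exists G : sgraph 'I_n,
     ~~ complete_graph G /\ connected_graph G /\
     num_free G = f /\ diam G = 2 /\ vertex_connectivity G = k)
  <->
  (f = 0 /\ 2 <= k <= n - 2) \/
  (f = 1 /\ 2 <= k <= n - 3) \/
  (2 <= f /\ 2 <= k /\ f + k <= n).
Proof.
split=> [[G [ncG [_ [fG [_ kG]]]]]|].
  (* These three bounds settle [f = 0], [f = 1] and [f >= 2] respectively. *)
  have := vertex_connectivity_le_card ncG.
  have := @vertex_connectivity_one_free _ G ncG.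
  have := num_free_add_connectivity ncG.
  by rewrite card_ord fG kG; lia.
case=> [[-> kn]|[[-> kn]|[f2 [k2 fkn]]]].
- exact: realizes_no_free.
- exact: realizes_one_free.
- exact: realizes_many_free.
Qed.
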